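(* Let $\mathfrak{g}_0$ be a compact semisimple real Lie algebra, $U$ a finite dimensional real $\mathfrak{g}_0$-module, $V=U^{\mathbb{C}}$, $\mathfrak{g}=\mathfrak{g}_0^{\mathbb{C}}$, $\mathfrak{n}_0=U\oplus\mathfrak{g}_0$ the real 2-step nilpotent Lie algebra described in the context and $\mathfrak{n}=V\oplus\mathfrak{g}=\mathfrak{n}_0^{\mathbb{C}}$. For $\sigma$ in the Weyl group $W$ let $T_\sigma\in GL(V)$ and $\varphi_\sigma\in\mathrm{Aut}(\mathfrak{g})\subset GL(\mathfrak{g})$ be the elements defined in the context, and let $\zeta_\sigma\in\mathrm{Aut}(\mathfrak{n})$ be the element with $\zeta_\sigma=T_\sigma$ on $V$ and $\zeta_\sigma=\varphi_\sigma$ on $\mathfrak{g}$. Then $\zeta_\sigma(\mathfrak{n}_0)=\mathfrak{n}_0$ and (the restriction of) $\zeta_\sigma$ lies in $\mathrm{Aut}(\mathfrak{n}_0)$. Moreover, $\zeta_\sigma$ is an isometry of $\mathfrak{n}_0$ with respect to any $\mathfrak{g}_0$-invariant inner product on $\mathfrak{n}_0$.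
   Context: Structure of $\mathfrak{n}_0$: fix a positive definite inner product $\langle\,,\rangle$ on $U\oplus\mathfrak{g}_0$ such that $U\perp\mathfrak{g}_0$, every $X\in\mathfrak{g}_0$ acts skew symmetrically on $U$, and $\mathrm{ad}X$ is skew symmetric on $\mathfrak{g}_0$; the bracket of $\mathfrak{n}_0$ is defined by: $\mathfrak{g}_0$ is central, $[\mathfrak{n}_0,\mathfrak{n}_0]\subseteq\mathfrak{g}_0$, and $\langle[u,u'],Z\rangle=\langle Z(u),u'\rangle$ for $u,u'\in U$, $Z\in\mathfrak{g}_0$. The bracket of $\mathfrak{n}$ is its complexification. Let $\mathfrak{h}$ be a Cartan subalgebra of $\mathfrak{g}$ with roots $\Phi$, base $\Delta$, positive roots $\Phi^+$; $\tau_\alpha=2H_\alpha/B(H_\alpha,H_\alpha)$, where $B$ is the Killing form of $\mathfrak{g}$ and $B(H,H_\alpha)=\alpha(H)$ for $H\in\mathfrak{h}$. Let $\{X_\beta:\beta\in\Phi;\tau_\alpha:\alpha\in\Delta\}$ be a Chevalley basis of $\mathfrak{g}$: a basis with $X_\beta\in\mathfrak{g}_\beta$, $[X_\alpha,X_{-\alpha}]=\tau_\alpha$, and $[X_\alpha,X_\beta]=C_{\alpha,\beta}X_{\alpha+\beta}$ with $C_{\alpha,\beta}=-C_{-\alpha,-\beta}$ whenever $\alpha,\beta,\alpha+\beta\in\Phi$; it is chosen so that $\mathfrak{g}_0=\mathbb{R}\text{-span}\{i\tau_\alpha\ (\alpha\in\Delta),\ X_\beta-X_{-\beta},\ iX_\beta+iX_{-\beta}\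 (\beta\in\Phi^+)\}$. $W$ is generated by the reflections $\sigma_\alpha(H)=H-\alpha(H)\tau_\alpha$ on $\mathfrak{h}$. For $\alpha\in\Phi$ let $T_\alpha=\exp(X_\alpha)\exp(-X_{-\alpha})\exp(X_\alpha)\in GL(V)$ and $\varphi_\alpha=\exp(\mathrm{ad}X_\alpha)\exp(-\mathrm{ad}X_{-\alpha})\exp(\mathrm{ad}X_\alpha)\in GL(\mathfrak{g})$. For $\sigma\in W$ choose an expression $\sigma=\sigma_{\beta_1}\circ\cdots\circ\sigma_{\beta_k}$, $\beta_i\in\Phi$, and put $T_\sigma=T_{\beta_1}\circ\cdots\circ T_{\beta_k}$ and $\varphi_\sigma=\varphi_{\beta_1}\circ\cdots\circ\varphi_{\beta_k}$ (same expression for both). An inner product on $\mathfrak{n}_0$ is $\mathfrak{g}_0$-invariant if every $X\in\mathfrak{g}_0$, acting on $\mathfrak{n}_0$ by the module action on $U$ and by $\mathrm{ad}X$ on $\mathfrak{g}_0$, is skew symmetric. *)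

(* Defs.v *)
From HB Require Import structures.
From mathcomp Require Import all_boot all_order all_algebra.
From mathcomp Require Import complex.
From mathcomp Require Import boolp classical_sets reals topology normedtype.
From mathcomp Require Import sequences.

Set Implicit Arguments.
Unset Strict Implicit.
Unset Printing Implicit Defensive.

Import Order.TTheory GRing.Theory Num.Theory.
Import numFieldNormedType.Exports.

Local Open Scope classical_set_scope.
Local Open Scope ring_scope.
Local Open Scope complex_scope.

(* Cplx x y stands for x + i y. *)
Record cplx (U : Type) : Type := Cplx { cre : U; cim : U }.

Section ComplexificationZmodule.
Variable U : zmodType.

Definition pair_of_cplx (z : cplx U) := (cre z, cim z).
Definition cplx_of_pair (p : U * U) := Cplx p.1 p.2.
Fact pair_of_cplxK : cancel pair_of_cplx cplx_of_pair. Proof. by case. Qed.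

HB.instance Definition _ := Choice.copy (cplx U) (can_type pair_of_cplxK).

Definition cplx_add (z w : cplx U) := Cplx (cre z + cre w) (cim z + cim w).
Definition cplx_opp (z : cplx U) := Cplx (- cre z) (- cim z).

Fact cplx_addA : associative cplx_add.
Proof. by move=> x y z; rewrite /cplx_add /= !addrA. Qed.
Fact cplx_addC : commutative cplx_add.
Proof. by move=> x y; rewrite /cplx_add addrC [cim x + _]addrC. Qed.
Fact cplx_add0 : left_id (Cplx 0 0) cplx_add.
Proof. by case=> x y; rewrite /cplx_add /= !add0r. Qed.
Fact cplx_addN : left_inverse (Cplx 0 0) cplx_opp cplx_add.
Proof. by move=> x; rewrite /cplx_add /= !addNr. Qed.

HB.instance Definition _ := GRing.isZmodule.Build (cplx U)
  cplx_addA cplx_addC cplx_add0 cplx_addN.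

End ComplexificationZmodule.

Section Complexification.
Import VectorInternalTheory.
Variables (R : realType) (U : vectType R).

Definition cplx_scale (c : R[i]) (z : cplx U) : cplx U :=
  Cplx (complex.Re c *: cre z - complex.Im c *: cim z)
       (complex.Re c *: cim z + complex.Im c *: cre z).

Fact cplx_scaleA a b z : cplx_scale a (cplx_scale b z) = cplx_scale (a * b) z.
Proof.
case: a b z => [a a'] [b b'] [x y]; rewrite /cplx_scale /=; congr Cplx.
  rewrite !scalerDr !scalerN !scalerA scalerBl scalerDl !opprD.
  by rewrite -!addrA; congr (_ + _); rewrite addrA addrC.
rewrite !scalerDr !scalerN !scalerA scalerBl scalerDl.
by rewrite -!addrA; congr (_ + _); rewrite addrA addrC.
Qed.

Fact cplx_scale1 : left_id 1 cplx_scale.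
Proof. by case=> x y; rewrite /cplx_scale /= !scale1r !scale0r subr0 addr0. Qed.

Fact cplx_scaleDr : right_distributive cplx_scale +%R.
Proof.
move=> [a b] [x y] [x' y']; rewrite /cplx_scale; congr Cplx => /=.
  by rewrite !scalerDr opprD addrACA.
by rewrite !scalerDr addrACA.
Qed.

Fact cplx_scaleDl z : {morph cplx_scale^~ z : a b / a + b}.
Proof.
case: z => x y [a b] [a' b']; rewrite /cplx_scale; congr Cplx => /=.
  by rewrite !scalerDl opprD addrACA.
by rewrite !scalerDl addrACA.
Qed.

HB.instance Definition _ := GRing.Zmodule_isLmodule.Build R[i] (cplx U)
  cplx_scaleA cplx_scale1 cplx_scaleDr cplx_scaleDl.

Fact cplx_vect_iso : Vector.axiom (dim U) (cplx U).
Proof.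
pose v : U -> 'rV[R]_(dim U) := @v2r R U.
pose f (z : cplx U) : 'rV[R[i]]_(dim U) :=
  \row_j (v (cre z) 0 j +i* v (cim z) 0 j).
pose g (r : 'rV[R[i]]_(dim U)) : cplx U :=
  Cplx (r2v (map_mx (@complex.Re R) r))
       (r2v (map_mx (@complex.Im R) r)).
have v2rD p q : v p + v q = v (p + q) by rewrite /v raddfD.
have v2rZ a p : a *: v p = v (a *: p) by rewrite /v linearZ.
have v2rB p q : v p - v q = v (p - q) by rewrite -scaleN1r v2rZ v2rD scaleN1r.
exists f.
  move=> [a b] [x y] [x' y']; apply/rowP=> j; rewrite !mxE.
  rewrite [cre _]/(a *: x - b *: y + x') [cim _]/(a *: y + b *: x + y').
  by rewrite -v2rD -v2rB -!v2rD -!v2rZ !mxE.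
exists g => [[x y]|r].
  by rewrite /g; congr Cplx; apply: (canLR (@v2rK _ _));
     apply/rowP=> j; rewrite !mxE.
apply/rowP=> j; rewrite !mxE /= /v !r2vK !mxE.
by case: (r 0 j).
Qed.

HB.instance Definition _ := Lmodule_hasFinDim.Build R[i] (cplx U) cplx_vect_iso.

End Complexification.

Definition creal (U : zmodType) (u : U) : cplx U := Cplx u 0.

(* The complex bilinear extension of a real bilinear map. *)
Definition cplx_bilin (A B C : zmodType) (b : A -> B -> C)
    (z : cplx A) (w : cplx B) : cplx C :=
  Cplx (b (cre z) (cre w) - b (cim z) (cim w))
       (b (cre z) (cim w) + b (cim z) (cre w)).

Definition real_span (R : realType) (V : lmodType R[i]) (s : seq V) : set V :=
  [set v | exists c : 'I_(size s) -> R, v = \sum_(i < size s) (c i)%:C *: s`_i].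

Section Lie.
Variables (K : fieldType) (L : vectType K).
Implicit Types (br : L -> L -> L) (A B : {vspace L}).

Definition is_bilinear (U V W : lmodType K) (b : U -> V -> W) : Prop :=
  (forall x, linear (b x)) /\ (forall y, linear (b^~ y)).

Definition is_lie_bracket br : Prop :=
  [/\ is_bilinear br, forall x, br x x = 0 &
      forall x y z, br x (br y z) + br y (br z x) + br z (br x y) = 0].

Definition is_lie_module br (M : lmodType K) (act : L -> M -> M) : Prop :=
  is_bilinear act /\
  forall x y m, act (br x y) m = act x (act y m) - act y (act x m).

Definition lie_aut br (f : L -> L) : Prop :=
  [/\ linear f, bijective f & {morph f : x y / br x y}].

(* [A, B]; brackets of basis vectors suffice by bilinearity. *)
Definition bracket_span br A B : {vspace L} :=
  <<[seq br x y | x <- vbasis A, y <- vbasis B]>>%VS.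

Definition lie_ideal br A : Prop := (bracket_span br fullv A <= A)%VS.

Definition lie_solvable br A : Prop :=
  exists n, iter n (fun B => bracket_span br B B) A = 0%VS.

Definition lie_nilpotent br A : Prop :=
  exists n, iter n (bracket_span br A) A = 0%VS.

Definition lie_semisimple br : Prop :=
  forall A, lie_ideal br A -> lie_solvable br A -> A = 0%VS.

Definition killing br (x y : L) : K :=
  \tr (\matrix_(i, j) coord (vbasis fullv) j (br x (br y (vbasis fullv)`_i))).

Definition cartan_subalgebra br (h : {vspace L}) : Prop :=
  [/\ (bracket_span br h h <= h)%VS, lie_nilpotent br h &
      forall x, (forall y, y \in h -> br x y \in h) -> x \in h].

End Lie.

Definition compact_semisimple (R : realType) (L : vectType R)
    (br : L -> L -> L) : Prop :=
  lie_semisimple br /\ forall x, x != 0 -> killing br x x < 0.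

Section Roots.
Variables (K : fieldType) (g : vectType K) (br : g -> g -> g) (h : {vspace g}).

Definition dual := 'Hom(subvs_of h, K^o).

Definition root_vector (a : dual) (x : g) : Prop :=
  forall H : subvs_of h, br (vsval H) x = a H *: x.

Definition is_root (a : dual) : Prop :=
  a != 0 /\ exists2 x, x != 0 & root_vector a x.

Definition root_system (Phi : seq dual) : Prop :=
  uniq Phi /\ forall a, (a \in Phi) <-> is_root a.

Definition nonneg_comb (Delta : seq dual) (a : dual) : Prop :=
  exists c : 'I_(size Delta) -> nat, a = \sum_(i < size Delta) Delta`_i *+ c i.

Definition root_base (Phi Delta : seq dual) : Prop :=
  [/\ {subset Delta <= Phi}, basis_of fullv Delta &
      forall a, a \in Phi -> nonneg_comb Delta a \/ nonneg_comb Delta (- a)].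

Definition positive_roots (Phi Delta : seq dual) : seq dual :=
  [seq a <- Phi | `[< nonneg_comb Delta a >]].

Variables (Phi Delta : seq dual) (Hv : dual -> subvs_of h).

(* Hv a is the vector H_a of h that represents a through the Killing form. *)
Definition killing_dual : Prop := forall a, a \in Phi ->
  forall H : subvs_of h, killing br (vsval H) (vsval (Hv a)) = a H.

Definition tau (a : dual) : subvs_of h :=
  (2 / killing br (vsval (Hv a)) (vsval (Hv a))) *: Hv a.

Definition reflection (a : dual) (H : subvs_of h) : subvs_of h :=
  H - (a H : K) *: tau a.

Inductive weyl : (subvs_of h -> subvs_of h) -> Prop :=
| weyl_refl a : a \in Phi -> weyl (reflection a)
| weyl_id : weyl id
| weyl_comp s t : weyl s -> weyl t -> weyl (s \o t)
| weyl_inv s t : weyl s -> cancel s t -> cancel t s -> weyl t.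

Definition chevalley_basis (X : dual -> g) : Prop :=
  [/\ basis_of fullv ([seq X b | b <- Phi] ++ [seq vsval (tau a) | a <- Delta]),
      forall b, b \in Phi -> root_vector b (X b),
      forall a, a \in Phi -> br (X a) (X (- a)) = vsval (tau a) &
      exists C : dual -> dual -> K, forall a b,
        a \in Phi -> b \in Phi -> a + b \in Phi ->
        br (X a) (X b) = C a b *: X (a + b) /\ C a b = - C (- a) (- b)].

End Roots.

Section CompactRealForm.
Variables (R : realType) (g0 : vectType R) (br : g0 -> g0 -> g0).
Let g := cplx g0.
Variables (h : {vspace g}) (Phi Delta : seq (dual h)).
Variables (Hv : dual h -> subvs_of h) (X : dual h -> g).

Definition compact_generators : seq g :=
  [seq 'i *: vsval (tau (cplx_bilin br) Hv a) | a <- Delta] ++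
  [seq X b - X (- b) | b <- positive_roots Phi Delta] ++
  [seq 'i *: X b + 'i *: X (- b) | b <- positive_roots Phi Delta].

Definition adapted_to_real_form : Prop :=
  range (@creal g0) = real_span compact_generators.

End CompactRealForm.

(* The exponential series of an endomorphism f, applied to v; its limit is
   taken coordinatewise in a basis. *)
Definition vexp (K : numFieldType) (V : vectType K) (f : V -> V) (v : V) : V :=
  \sum_(i < \dim {:V})
    lim (coord (vbasis fullv) i (\sum_(k < n) (k`!%:R)^-1 *: iter k f v)
         @[n --> \oo]) *: (vbasis fullv)`_i.

Definition weyl_lift1 (K : numFieldType) (g V : vectType K) (h : {vspace g})
    (act : g -> V -> V) (X : dual h -> g) (a : dual h) : V -> V :=
  vexp (act (X a)) \o vexp (act (- X (- a))) \o vexp (act (X a)).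

Definition compose_all (I V : Type) (F : I -> V -> V) (s : seq I) : V -> V :=
  foldr (fun i f => F i \o f) id s.

Section Nilpotent.
Variables (R : realType) (g0 U : vectType R).
Let n0 : vectType R := (U * g0)%type.
Variables (br : g0 -> g0 -> g0) (act : g0 -> U -> U).
Implicit Types (ip : {dot n0 for idfun}) (nbr : n0 -> n0 -> n0).

Definition adapted_inner_product ip : Prop :=
  [/\ forall u Z, ip (u, 0) (0, Z) = 0,
      forall X u u', ip (act X u, 0) (u', 0) = - ip (u, 0) (act X u', 0) &
      forall X Y Z, ip (0, br X Y) (0, Z) = - ip (0, Y) (0, br X Z)].

Definition is_n0_bracket ip nbr : Prop :=
  [/\ is_lie_bracket nbr,
      forall Z x, nbr (0, Z) x = 0,
      forall x y, (nbr x y).1 = 0 &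
      forall u u' Z, ip (nbr (u, 0) (u', 0)) (0, Z) = ip (act Z u, 0) (u', 0)].

Definition invariant_inner_product ip : Prop :=
  forall X x y, ip (act X x.1, br X x.2) y = - ip x (act X y.1, br X y.2).

(* The identification of the complexification of n0 with V (+) g. *)
Definition n_V (z : cplx n0) : cplx U := Cplx (cre z).1 (cim z).1.
Definition n_g (z : cplx n0) : cplx g0 := Cplx (cre z).2 (cim z).2.
Definition n_sum (v : cplx U) (Z : cplx g0) : cplx n0 :=
  Cplx (cre v, cre Z) (cim v, cim Z).

Definition zeta (T : cplx U -> cplx U) (phi : cplx g0 -> cplx g0)
    (z : cplx n0) : cplx n0 := n_sum (T (n_V z)) (phi (n_g z)).

End Nilpotent.

(* Main.v *)
Require Import Defs.
From HB Require Import structures.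
From mathcomp Require Import all_boot all_order all_algebra.
From mathcomp Require Import complex.
From mathcomp Require Import boolp classical_sets reals topology normedtype.

Set Implicit Arguments.
Unset Strict Implicit.
Unset Printing Implicit Defensive.

Import Order.TTheory GRing.Theory Num.Theory.

Local Open Scope classical_set_scope.
Local Open Scope ring_scope.

(** Write [e = X a], [f = X (- a)], [t = tau a] for a root [a]. Everything rests
on two facts about the elements [T_a = exp e * exp (- f) * exp e].

An exponential of a nilpotent derivation is an automorphism. Every [x] in the
complexified compact algebra acts on the complexification of [n0 = U + g0] by a
derivation of the bracket, and infinitesimally preserves the complex bilinear
extension of any invariant inner product. Hence each of the three factors of
[T_a], acting on [V + g], is an automorphism which preserves that bilinear form.
Both assertions are instances of one statement, [vexp_leibniz], on a bilinear
pairing between three modules; for the form the target is the trivial module.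
The exponential series are finite sums because [t] has weight 2 on [e], which
forces [e] to act nilpotently in every finite-dimensional module
([nilpotent_of_weight2]).

[T_a] is real. The Chevalley basis is adapted to the compact form, so that
complex conjugation sends [e] to [- f] ([cconj_X]); it therefore turns [T_a] into
[exp (- f) * exp e * exp (- f)]. This is again [T_a] ([sl2_braid]): the adjoint
action of [T_a] sends [e] to [- f], hence [T_a] conjugates [exp e] to
[exp (- f)], and [exp e] can then be cancelled. So [T_a] commutes with conjugation and preserves [n0], where the
complex bilinear extension is the given inner product.

It remains to see that [e], [f], [t] do form an sl2-triple for every root. The
roots are real on the coroots since [ad] of the compact form is skew, so that
conjugation exchanges the root spaces of [a] and [- a]; and [t] does not vanish,
because otherwise the real and imaginary parts of [e] would commute, which
positivity of the inner product excludes ([root_killing_neq0]). *)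

(** * Exponentials of nilpotent endomorphisms *)

Definition nilpotent (V : zmodType) (f : V -> V) : Prop :=
  exists N, forall v, iter N f v = 0.

Lemma iter_ge0 (V : zmodType) (f : V -> V) N n v :
  (forall u, iter N f u = 0) -> (N <= n)%N -> iter n f v = 0.
Proof. by move=> fN /subnKC <-; rewrite iterD fN. Qed.

Lemma iter_intertwine (V W : Type) (A : V -> V) (B : W -> W) (g : W -> V) k w :
  (forall u, A (g u) = g (B u)) -> iter k A (g w) = g (iter k B w).
Proof. by move=> AgB; elim: k => //= k ->; rewrite AgB. Qed.

Section Exponential.
Import numFieldNormedType.Exports.
Variable K : numFieldType.
Implicit Types V W : vectType K.

Definition exp_sum V (n : nat) (f : V -> V) (v : V) : V :=
  \sum_(k < n) (k`!%:R)^-1 *: iter k f v.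

Lemma exp_sum_stable V N n (f : V -> V) v :
  (forall u, iter N f u = 0) -> (N <= n)%N -> exp_sum n f v = exp_sum N f v.
Proof.
move=> fN Nn; rewrite /exp_sum.
rewrite (big_ord_widen n (fun k => (k`!%:R)^-1 *: iter k f v) Nn).
rewrite [RHS]big_mkcond; apply: eq_bigr => k _; case: ltnP => // Nk.
by rewrite (iter_ge0 _ fN Nk) scaler0.
Qed.

Lemma vexp_nilpotent V N (f : V -> V) v :
  (forall u, iter N f u = 0) -> vexp f v = exp_sum N f v.
Proof.
move=> fN; rewrite [RHS](coord_vbasis (memvf _)) /vexp.
apply: eq_bigr => i _; congr (_ *: _).
apply: lim_near_cst; first exact: norm_hausdorff.
exists N => // n /= Nn.
by rewrite -[X in coord _ _ X]/(exp_sum n f v) (exp_sum_stable _ fN Nn).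
Qed.

Lemma vexp_ge V n (f : V -> V) v :
  (forall u, iter n f u = 0) -> forall m, (n <= m)%N -> vexp f v = exp_sum m f v.
Proof. by move=> fn m nm; rewrite (vexp_nilpotent _ fn) (exp_sum_stable _ fn nm). Qed.

(** An additive map is linear over the rationals, and the exponential series
has rational coefficients; so semilinear maps are covered too. *)
Lemma vexp_intertwine V W (A : V -> V) (B : W -> W) (g : {additive W -> V}) w :
  nilpotent A -> nilpotent B -> (forall u, A (g u) = g (B u)) ->
  vexp A (g w) = g (vexp B w).
Proof.
move=> [n An] [m Bm] AgB.
have gZ k u : g ((k`!%:R : K)^-1 *: u) = (k`!%:R)^-1 *: g u.
  have k0 : (k`!%:R : K) != 0 by rewrite pnatr_eq0 -lt0n fact_gt0.
  apply: (can_inj (scalerK k0)).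
  by rewrite scalerKV // scaler_nat -raddfMn -scaler_nat scalerKV.
rewrite (vexp_ge _ An (leq_addr m n)) (vexp_ge _ Bm (leq_addl n m)) /exp_sum raddf_sum.
by apply: eq_bigr => k _; rewrite (iter_intertwine _ _ AgB) gZ.
Qed.

Lemma vexp_lin V (f : V -> V) : linear f -> nilpotent f -> linear (vexp f).
Proof.
move=> lf [n fn] a u v; rewrite !(vexp_nilpotent _ fn) /exp_sum scaler_sumr -big_split.
apply: eq_bigr => k _ /=; rewrite scalerA mulrC -scalerA -scalerDr; congr (_ *: _).
by elim: (k : nat) => //= j ->; rewrite lf.
Qed.

Lemma leibniz_iter V1 V2 V3 (b : V1 -> V2 -> V3)
    (A1 : V1 -> V1) (A2 : V2 -> V2) (A3 : V3 -> V3) x y k :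
  linear A3 ->
  (forall u v, A3 (b u v) = b (A1 u) v + b u (A2 v)) ->
  iter k A3 (b x y) =
    \sum_(i < k.+1) b (iter i A1 x) (iter (k - i) A2 y) *+ 'C(k, i).
Proof.
move=> lA leib.
pose A3l : {linear _ -> _} := HB.pack A3 (GRing.isLinear.Build _ _ _ _ A3 lA).
elim: k => [|k IH]; first by rewrite big_ord1 mulr1n.
rewrite iterS IH -[A3 _]/(A3l _) linear_sum.
under eq_bigr => i _ do rewrite linearMn /= leib mulrnDl -iterS -[A2 _]iterS.
rewrite big_split /= [in RHS]big_ord_recl bin0 /= ?subn0.
under [in RHS]eq_bigr => i _ do rewrite binS mulrnDr subSS.
rewrite [in RHS]big_split /= addrC addrA; congr (_ + _).
rewrite [in LHS]big_ord_recl bin0 /= subn0; congr (_ + _).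
rewrite [in RHS]big_ord_recr /= bin_small // mulr0n addr0.
by apply: eq_bigr => i _; rewrite /bump /= add1n -(iterS _ A2) subnSK.
Qed.

(** The Cauchy product of the two exponential series is the exponential series
of the derivation; both double sums are finite by nilpotency, so the reindexing
of the square by its antidiagonals is exact. *)
Lemma vexp_leibniz V1 V2 V3 (b : V1 -> V2 -> V3)
    (A1 : V1 -> V1) (A2 : V2 -> V2) (A3 : V3 -> V3) x y :
  is_bilinear b -> linear A3 -> nilpotent A1 -> nilpotent A2 -> nilpotent A3 ->
  (forall u v, A3 (b u v) = b (A1 u) v + b u (A2 v)) ->
  vexp A3 (b x y) = b (vexp A1 x) (vexp A2 y).
Proof.
move=> bb lA [n1 A1n] [n2 A2n] [n3 A3n] leib.
(* [N] bounds the three indices of nilpotency, and the antidiagonals of the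
square of side [N] are among the first [N + N]. *)
pose N := (n1 + n2 + n3)%N.
have n1N : (n1 <= N)%N by rewrite /N -addnA leq_addr.
have n2N : (n2 <= N)%N by rewrite /N addnAC leq_addl.
have n3N : (n3 <= N + N)%N by rewrite (leq_trans (leq_addl (n1 + n2) n3)) ?leq_addr.
rewrite (vexp_ge _ A1n n1N) (vexp_ge _ A2n n2N) (vexp_ge _ A3n n3N) /exp_sum.
pose F i j := (i`!%:R)^-1 * (j`!%:R)^-1 *: b (iter i A1 x) (iter j A2 y).
have [br bl] := bb.
pose br' u : {linear _ -> _} :=
  HB.pack (b u) (GRing.isLinear.Build _ _ _ _ (b u) (br u)).
pose bl' u : {linear _ -> _} :=
  HB.pack (b^~ u) (GRing.isLinear.Build _ _ _ _ (b^~ u) (bl u)).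
have F0r i j : (N <= j)%N -> F i j = 0.
  move=> Nj; rewrite /F (iter_ge0 _ A2n (leq_trans n2N Nj)).
  by rewrite -[b _ 0]/(br' _ 0) linear0 scaler0.
have F0l i j : (N <= i)%N -> F i j = 0.
  move=> Ni; rewrite /F (iter_ge0 _ A1n (leq_trans n1N Ni)).
  by rewrite -[b 0 _]/(bl' _ 0) linear0 scaler0.
transitivity (\sum_(0 <= k < N + N) \sum_(0 <= i < N + N | (i <= k)%N) F i (k - i)%N).
  rewrite big_mkord; apply: eq_bigr => k _; rewrite (leibniz_iter _ _ _ lA leib).
  rewrite scaler_sumr big_mkord.
  rewrite (big_ord_widen (N + N) (fun i => (k`!%:R)^-1 *:
    (b (iter i A1 x) (iter (k - i) A2 y) *+ 'C(k, i)))) //.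
  apply: eq_big => i; first by rewrite ltnS.
  rewrite ltnS => ik; rewrite /F -[b _ _ *+ _]scaler_nat scalerA; congr (_ *: _).
  rewrite -(bin_fact ik) !natrM [in LHS]invfM.
  rewrite mulrAC mulVf ?mul1r ?invfM // pnatr_eq0 -lt0n bin_gt0 //.
rewrite (exchange_big_dep_nat xpredT) //=.
transitivity (\sum_(0 <= i < N) \sum_(0 <= j < N) F i j); last first.
  rewrite big_mkord -[RHS]/(bl' _ _) linear_sum; apply: eq_bigr => i _ /=.
  rewrite -[RHS]/(br' _ _) linear_sum big_mkord; apply: eq_bigr => j _ /=.
  rewrite -[b _ _]/(br' _ _) linearZ /= -[b _ _]/(bl' _ _) linearZ /=.
  by rewrite scalerA mulrC.
rewrite (big_cat_nat _ (leq_addr N N)) //= [X in _ + X]big_nat_cond.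
rewrite [X in _ + X]big1 ?addr0; last first.
  by move=> i /andP[/andP[Ni _] _]; rewrite big1 // => k _; rewrite F0l.
apply: eq_big_nat => i /andP[_ iN].
rewrite (big_cat_nat (n := i)) ?(leq_trans (ltnW iN)) ?leq_addr //=.
rewrite big_nat_cond big1 ?add0r; last first.
  by move=> k /andP[/andP[_ +] ik]; rewrite ltnNge ik.
have := big_addn 0 (N + N) i (leq i) (fun k => F i (k - i)%N); rewrite add0n => ->.
have NNi : (N <= N + N - i)%N.
  by rewrite leq_subRL ?leq_add2r ?(leq_trans (ltnW iN)) ?leq_addr // ltnW.
rewrite (big_cat_nat _ NNi) //=; under eq_bigl => j do rewrite leq_addl.
under eq_bigr => j _ do rewrite addnK.
rewrite [X in _ + X]big_nat_cond [X in _ + X]big1 ?addr0 // => j /andP[/andP[Nj _] _].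
by rewrite addnK F0r.
Qed.

End Exponential.

Lemma injective_bijective (K : fieldType) (V : vectType K) (f : V -> V) :
  linear f -> injective f -> bijective f.
Proof.
move=> lf injf.
pose fl : {linear _ -> _} := HB.pack f (GRing.isLinear.Build _ _ _ _ f lf).
have fE v : linfun fl v = f v by rewrite lfunE.
have kf : lker (linfun fl) == 0%VS.
  by apply/lker0P => u v; rewrite !fE => /injf.
exists ((linfun fl)^-1%VF) => v; first by rewrite -fE lker0_lfunK.
by rewrite -fE lker0_lfunVK.
Qed.

(** The inverse of [vexp f] is the exponential of right multiplication by [- f],
evaluated at the identity: the evaluation pairing between endomorphisms and
vectors is annihilated by the sum of the two actions. *)
Lemma vexp_bij (K : numFieldType) (V : vectType K) (f : V -> V) :
  linear f -> nilpotent f -> bijective (vexp f).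
Proof.
move=> lf nf; apply: injective_bijective; first exact: vexp_lin.
pose fl : {linear _ -> _} := HB.pack f (GRing.isLinear.Build _ _ _ _ f lf).
have fE v : linfun fl v = f v by rewrite lfunE.
pose A1 (g : 'End(V)) : 'End(V) := - (g \o linfun fl)%VF.
pose b (g : 'End(V)) (v : V) := g v.
have bb : is_bilinear b.
  split=> [g|v] a x y; rewrite /b ?linearP //.
  by rewrite !lfun_simp.
have nA1 : nilpotent A1.
  case: nf => n fn; exists n => g.
  have it k v : (iter k A1 g) v = (-1) ^+ k *: g (iter k f v).
    elim: k v => [|k IH] v; first by rewrite scale1r.
    rewrite iterS {1}/A1 opp_lfunE comp_lfunE IH fE -iterSr.
    by rewrite exprS mulN1r scaleNr.
  by apply/lfunP => v; rewrite it fn linear0 scaler0 zero_lfunE.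
have n0 : nilpotent (fun _ : V => 0 : V) by exists 1%N.
have l0 : linear (fun _ : V => 0 : V) by move=> a u v; rewrite scaler0 addr0.
have leib g v : (fun _ : V => 0) (b g v) = b (A1 g) v + b g (f v).
  by rewrite /b /A1 opp_lfunE comp_lfunE fE addNr.
apply: (can_inj (g := vexp A1 \1%VF)) => v.
rewrite -[LHS]/(b _ _) -(vexp_leibniz \1%VF v bb l0 nA1 nf n0 leib).
case: n0 => n n0; rewrite (vexp_ge _ (n := 1) _ (leqnn 1)) //.
by rewrite /exp_sum big_ord1 invr1 scale1r /b id_lfunE.
Qed.

(** * Modules over sl2 *)

Section Eigenvectors.
Import VectorInternalTheory.

(** An endomorphism of a finite-dimensional space has finitely many
eigenvalues. *)
Lemma eigenvectors_vanish (K : fieldType) (W : vectType K) (L : {linear W -> W})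
    (c : nat -> K) (w : nat -> W) :
  injective c -> (forall k, L (w k) = c k *: w k) -> exists k, w k = 0.
Proof.
move=> injc Lw; apply/not_existsP => nzw.
pose A := lin1_mx (v2r \o L \o r2v).
have rootA k : root (char_poly A) (c k).
  rewrite -eigenvalue_root_char; apply/eigenvalueP; exists (v2r (w k)).
    by rewrite mul_rV_lin1 /= v2rK Lw linearZ.
  by apply/eqP => /(congr1 r2v); rewrite v2rK linear0; exact: nzw.
have := @max_poly_roots _ (char_poly A) (map c (iota 0 (dim W).+1)).
rewrite size_map size_iota size_char_poly ltnn map_inj_uniq // iota_uniq.
have -> : char_poly A != 0 by rewrite -size_poly_eq0 size_char_poly.
have -> : all (root (char_poly A)) (map c (iota 0 (dim W).+1)).
  by apply/allP => x /mapP[k _ ->].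
by move=> /(_ isT isT isT).
Qed.

End Eigenvectors.

(** The powers of [e] are eigenvectors of the commutator with [t], with the
pairwise distinct eigenvalues [2 * k], so that one of them is zero. *)
Lemma nilpotent_of_weight2 (K : numFieldType) (V : vectType K) (t e : V -> V) :
  linear t -> linear e -> (forall v, t (e v) = e (t v) + 2 *: e v) -> nilpotent e.
Proof.
move=> lt le te.
pose tl : {linear _ -> _} := HB.pack t (GRing.isLinear.Build _ _ _ _ t lt).
pose el : {linear _ -> _} := HB.pack e (GRing.isLinear.Build _ _ _ _ e le).
have tE v : linfun tl v = t v by rewrite lfunE.
have eE v : linfun el v = e v by rewrite lfunE.
pose L (g : 'End(V)) : 'End(V) := (linfun tl \o g)%VF - (g \o linfun tl)%VF.
have LE g v : L g v = t (g v) - g (t v).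
  by rewrite /L add_lfunE opp_lfunE !comp_lfunE !tE.
have lL : linear L.
  move=> a g g'; apply/lfunP => v.
  rewrite LE 3!add_lfunE 3!scale_lfunE !LE lt.
  by rewrite scalerBr opprD addrACA.
pose Ll : {linear _ -> _} := HB.pack L (GRing.isLinear.Build _ _ _ _ L lL).
pose w k : 'End(V) := iter k (fun g => linfun el \o g)%VF \1%VF.
have wE k v : w k v = iter k e v.
  elim: k => [|k IH]; first by rewrite id_lfunE.
  by rewrite iterS -IH -eE -comp_lfunE.
have tek k v : t (iter k e v) = iter k e (t v) + (2 * k)%:R *: iter k e v.
  elim: k v => [|k IH] v; first by rewrite muln0 scale0r addr0.
  rewrite iterS te IH -[e (_ + _)]/(el _) linearD linearZ -addrA -scalerDl.
  by rewrite -natrD mulnS addnC.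
have [|k|k wk0] := @eigenvectors_vanish K _ Ll (fun k => (2 * k)%:R) w.
- by move=> i j /eqP; rewrite eqr_nat eqn_pmul2l // => /eqP.
- by apply/lfunP => v; rewrite scale_lfunE [LHS]LE !wE tek addrAC subrr add0r.
- by exists k => v; rewrite -wE wk0 zero_lfunE.
Qed.

Section Sl2Triple.
Variables (K : numFieldType) (g : vectType K) (br : g -> g -> g).

Definition sl2_triple (e f t : g) : Prop :=
  [/\ br e f = t, br t e = 2 *: e & br t f = - 2 *: f].

Lemma module_leibniz (V : vectType K) (act : g -> V -> V) x y v :
  is_lie_module br act -> act x (act y v) = act (br x y) v + act y (act x v).
Proof. by move=> [_ ->]; rewrite subrK. Qed.

Lemma module_nilpotent (V : vectType K) (act : g -> V -> V) t e :
  is_lie_module br act -> br t e = 2 *: e -> nilpotent (act e).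
Proof.
move=> mact te; have [[actr actl] _] := mact.
apply: (nilpotent_of_weight2 (actr t) (actr e)) => v.
rewrite (module_leibniz _ _ _ mact) te addrC; congr (_ + _).
pose al : {linear _ -> _} :=
  HB.pack (act^~ v) (GRing.isLinear.Build _ _ _ _ (act^~ v) (actl v)).
by rewrite -[LHS]/(al _) linearZ.
Qed.

End Sl2Triple.

Lemma vexp_quadratic (K : numFieldType) (V : vectType K) (f : V -> V) y :
  linear f -> nilpotent f -> f (f (f y)) = 0 ->
  vexp f y = y + f y + 2^-1 *: f (f y).
Proof.
move=> lf [n fn] f3.
pose fl : {linear _ -> _} := HB.pack f (GRing.isLinear.Build _ _ _ _ f lf).
rewrite (vexp_ge _ fn (leq_addl 3 n)) /exp_sum !big_ord_recl big1 => [|k _].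
  by rewrite /= invr1 !scale1r addr0 addrA.
suff -> : iter (lift ord0 (lift ord0 (lift ord0 k))) f y = 0 by rewrite scaler0.
rewrite -[LHS]/(iter (3 + k) f y) addnC iterD /= f3.
by elim: (k : nat) => //= j ->; rewrite -[f 0]/(fl 0) linear0.
Qed.

Section Bilinear.
Variables (K : fieldType) (U V W : lmodType K) (b : U -> V -> W).
Hypothesis bb : is_bilinear b.

Let br x : {linear V -> W} :=
  HB.pack (b x) (GRing.isLinear.Build _ _ _ _ (b x) (bb.1 x)).
Let bl y : {linear U -> W} :=
  HB.pack (b^~ y) (GRing.isLinear.Build _ _ _ _ (b^~ y) (bb.2 y)).

Lemma bilin0l y : b 0 y = 0. Proof. exact: linear0 (bl y). Qed.
Lemma bilin0r x : b x 0 = 0. Proof. exact: linear0 (br x). Qed.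
Lemma bilinDl x x' y : b (x + x') y = b x y + b x' y.
Proof. exact: linearD (bl y) _ _. Qed.
Lemma bilinDr x y y' : b x (y + y') = b x y + b x y'.
Proof. exact: linearD (br x) _ _. Qed.
Lemma bilinNl x y : b (- x) y = - b x y. Proof. exact: linearN (bl y) _. Qed.
Lemma bilinNr x y : b x (- y) = - b x y. Proof. exact: linearN (br x) _. Qed.
Lemma bilinBl x x' y : b (x - x') y = b x y - b x' y.
Proof. exact: linearB (bl y) _ _. Qed.
Lemma bilinBr x y y' : b x (y - y') = b x y - b x y'.
Proof. exact: linearB (br x) _ _. Qed.
Lemma bilinZl a x y : b (a *: x) y = a *: b x y.
Proof. exact: (linearZ_LR (bl y)). Qed.
Lemma bilinZr a x y : b x (a *: y) = a *: b x y.
Proof. exact: (linearZ_LR (br x)). Qed.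
Lemma bilin_suml (I : finType) (F : I -> U) y : b (\sum_i F i) y = \sum_i b (F i) y.
Proof. exact: (linear_sum (bl y)). Qed.

End Bilinear.

Section Braid.
Variables (K : numFieldType) (g : vectType K) (br : g -> g -> g).
Hypothesis br_lie : is_lie_bracket br.

Lemma lie_bilinear : is_bilinear br. Proof. by case: br_lie. Qed.

Lemma lie_alternating x : br x x = 0. Proof. by case: br_lie. Qed.

Lemma lie_antisym x y : br x y = - br y x.
Proof.
apply/eqP; rewrite -subr_eq0 opprK; apply/eqP.
have := lie_alternating (x + y).
rewrite (bilinDl lie_bilinear) !(bilinDr lie_bilinear) !lie_alternating.
by rewrite add0r addr0.
Qed.

Lemma adjoint_module : is_lie_module br br.
Proof.
split=> [|x y z]; first exact: lie_bilinear.
have [_ _ /(_ x y z) /eqP] := br_lie.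
rewrite addrC addr_eq0 => /eqP E; rewrite lie_antisym E opprK; congr (_ + _).
by rewrite -(bilinNr lie_bilinear) -lie_antisym.
Qed.

Variables (V : vectType K) (act : g -> V -> V).
Hypothesis act_module : is_lie_module br act.

(** The action is itself a pairing of the adjoint module with [V], to which the
Leibniz rule applies. *)
Lemma vexp_module x y v : nilpotent (br x) -> nilpotent (act x) ->
  vexp (act x) (act y v) = act (vexp (br x) y) (vexp (act x) v).
Proof.
move=> nb na; have [bact _] := act_module.
apply: (vexp_leibniz _ _ bact (bact.1 x) nb na na) => u w.
exact: (module_leibniz _ _ _ act_module).
Qed.

Variables (e f t : g).
Hypothesis eft : sl2_triple br e f t.

(** [T = exp e * exp (- f) * exp e] is the image of the matrix with rows [0 1]
and [-1 0] of SL2, whose adjoint action sends [e] to [- f]. *)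
Lemma sl2_lift_adjoint : vexp (br e) (vexp (br (- f)) (vexp (br e) e)) = - f.
Proof.
have [ef te tf] := eft.
have bb := lie_bilinear.
have et : br e t = - (2 *: e) by rewrite lie_antisym te.
have fe : br (- f) e = t by rewrite (bilinNl bb) -lie_antisym.
have ft : br (- f) t = - 2 *: f by rewrite (bilinNl bb) -lie_antisym.
have ff : br (- f) f = 0 by rewrite (bilinNl bb) lie_alternating oppr0.
have ne := module_nilpotent adjoint_module te.
have nf : nilpotent (br (- f)).
  apply: (module_nilpotent (t := - t) adjoint_module).
  by rewrite (bilinNl bb) (bilinNr bb) opprK tf scalerN scaleNr.
have half2 (x : g) : 2^-1 *: (2 *: x) = x.
  by rewrite scalerA mulVf ?scale1r // pnatr_eq0.
rewrite (vexp_quadratic (y := e) (bb.1 e) ne) !(lie_alternating, bilin0r bb) //.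
rewrite scaler0 !addr0 (vexp_quadratic (bb.1 (- f)) nf); last first.
  by rewrite fe ft (bilinZr bb) ff scaler0.
rewrite fe ft scaleNr scalerN half2.
have e1 : br e (e + t - f) = - (2 *: e) - t.
  by rewrite (bilinBr bb) (bilinDr bb) lie_alternating et ef add0r.
have e2 : br e (- (2 *: e) - t) = 2 *: e.
  rewrite (bilinBr bb) (bilinNr bb) (bilinZr bb) lie_alternating et.
  by rewrite scaler0 oppr0 sub0r opprK.
rewrite (vexp_quadratic (bb.1 e) ne); last first.
  by rewrite e1 e2 (bilinZr bb) lie_alternating scaler0.
rewrite e1 e2 half2.
rewrite scaler_nat mulr2n opprD !addrA (ACl (1*4*(2*6)*(5*7)*3)%AC) /=.
by rewrite !subrr addNr !add0r.
Qed.

(** [T = exp e * exp (- f) * exp e] intertwines [e] with [- f], so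
[T * exp e = exp (- f) * T]; cancelling the last factor [exp e] on both sides gives
the identity. *)
Lemma sl2_braid v :
  vexp (act e) (vexp (act (- f)) (vexp (act e) v)) =
  vexp (act (- f)) (vexp (act e) (vexp (act (- f)) v)).
Proof.
have [ef te tf] := eft.
have bb := lie_bilinear.
have [[actr actl] _] := act_module.
have mtf : br (- t) (- f) = 2 *: - f.
  by rewrite (bilinNl bb) (bilinNr bb) opprK tf scalerN scaleNr.
have ne := module_nilpotent adjoint_module te.
have nf := module_nilpotent adjoint_module mtf.
have nae := module_nilpotent act_module te.
have naf := module_nilpotent act_module mtf.
pose T v := vexp (act e) (vexp (act (- f)) (vexp (act e) v)).
have lT : linear T.
  move=> a x y; rewrite /T (vexp_lin (actr e) nae) (vexp_lin (actr (- f)) naf).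
  by rewrite (vexp_lin (actr e) nae).
pose Tl : {linear _ -> _} := HB.pack T (GRing.isLinear.Build _ _ _ _ T lT).
have T_act u : act (- f) (Tl u) = Tl (act e u).
  by rewrite /= /T !vexp_module // sl2_lift_adjoint.
have [G GK KG] := vexp_bij (actr e) nae.
have := vexp_intertwine (G v) naf nae T_act.
by rewrite /= /T KG => <-.
Qed.

End Braid.

Section WeylLift.
Variables (K : numFieldType) (g : vectType K) (br : g -> g -> g).
Hypothesis br_lie : is_lie_bracket br.
Variables (h : {vspace g}) (X : dual h -> g) (a : dual h) (t : g).
Hypothesis eft : sl2_triple br (X a) (X (- a)) t.
Implicit Types V W : vectType K.

Lemma nilpotent_X V (act : g -> V -> V) :
  is_lie_module br act -> nilpotent (act (X a)).
Proof. by case: eft => _ te _ mact; exact: module_nilpotent te. Qed.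

Lemma nilpotent_XN V (act : g -> V -> V) :
  is_lie_module br act -> nilpotent (act (- X (- a))).
Proof.
case: eft => _ _ tf mact; have bb := lie_bilinear br_lie.
apply: (module_nilpotent (t := - t) mact).
by rewrite (bilinNl bb) (bilinNr bb) opprK tf scalerN scaleNr.
Qed.

Lemma weyl_lift_bij V (act : g -> V -> V) :
  is_lie_module br act -> bijective (weyl_lift1 act X a).
Proof.
move=> mact; have [[actr _] _] := mact.
have be := vexp_bij (actr (X a)) (nilpotent_X mact).
have bf := vexp_bij (actr (- X (- a))) (nilpotent_XN mact).
exact: bij_comp (bij_comp be bf) be.
Qed.

Lemma weyl_lift_linear V (act : g -> V -> V) :
  is_lie_module br act -> linear (weyl_lift1 act X a).
Proof.
move=> mact c u v; have [[actr _] _] := mact.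
have le := vexp_lin (actr (X a)) (nilpotent_X mact).
have lf := vexp_lin (actr (- X (- a))) (nilpotent_XN mact).
by rewrite /weyl_lift1 /= le lf le.
Qed.

Lemma weyl_lift_leibniz V1 V2 V3 (act1 : g -> V1 -> V1) (act2 : g -> V2 -> V2)
    (act3 : g -> V3 -> V3) (b : V1 -> V2 -> V3) y z :
  is_lie_module br act1 -> is_lie_module br act2 -> is_lie_module br act3 ->
  is_bilinear b ->
  (forall x y z, act3 x (b y z) = b (act1 x y) z + b y (act2 x z)) ->
  weyl_lift1 act3 X a (b y z) = b (weyl_lift1 act1 X a y) (weyl_lift1 act2 X a z).
Proof.
move=> m1 m2 m3 bb leib; have [[act3r _] _] := m3; rewrite /weyl_lift1 /=.
have E u v := vexp_leibniz u v bb (act3r (X a)) (nilpotent_X m1)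
  (nilpotent_X m2) (nilpotent_X m3) (leib (X a)).
have F u v := vexp_leibniz u v bb (act3r (- X (- a))) (nilpotent_XN m1)
  (nilpotent_XN m2) (nilpotent_XN m3) (leib (- X (- a))).
by rewrite E F E.
Qed.

Lemma weyl_lift_intertwine V W (actV : g -> V -> V) (actW : g -> W -> W)
    (f : {additive W -> V}) w :
  is_lie_module br actV -> is_lie_module br actW ->
  (forall x u, actV x (f u) = f (actW x u)) ->
  weyl_lift1 actV X a (f w) = f (weyl_lift1 actW X a w).
Proof.
move=> mV mW eqf; rewrite /weyl_lift1 /=.
have E u := vexp_intertwine u (nilpotent_X mV) (nilpotent_X mW) (eqf (X a)).
have F u := vexp_intertwine u (nilpotent_XN mV) (nilpotent_XN mW)
  (eqf (- X (- a))).
by rewrite E F E.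
Qed.

(** An invariant form is a pairing with values in the trivial module. *)
Definition trivial_action V (x : g) (v : V) : V := 0.

Lemma trivial_module V : is_lie_module br (@trivial_action V).
Proof.
split=> [|x y m]; last by rewrite /trivial_action subr0.
by split=> u c v w; rewrite /trivial_action scaler0 addr0.
Qed.

Lemma weyl_lift_trivial V v : weyl_lift1 (@trivial_action V) X a v = v.
Proof.
have vexp0 x (w : V) : vexp (trivial_action x) w = w.
  rewrite (vexp_nilpotent (N := 1)) // /exp_sum big_ord1 invr1.
  by rewrite scale1r.
by rewrite /weyl_lift1 /= !vexp0.
Qed.

End WeylLift.

(** * Complexification *)

Definition cconj (U : zmodType) (z : cplx U) : cplx U := Cplx (cre z) (- cim z).

Lemma cplxP (U : Type) (z w : cplx U) : cre z = cre w -> cim z = cim w -> z = w.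
Proof. by case: z w => [x y] [u v] /= -> ->. Qed.

Section ComplexBilinear.
Variable R : realType.
Implicit Types A B C G : vectType R.

Lemma cconj_additive A : {morph (@cconj A) : x y / x - y}.
Proof. by move=> x y; apply: cplxP; rewrite //= opprD. Qed.

HB.instance Definition _ A :=
  GRing.isZmodMorphism.Build (cplx A) (cplx A) (@cconj A) (@cconj_additive A).

Lemma cconjK A : involutive (@cconj A).
Proof. by move=> z; apply: cplxP; rewrite //= opprK. Qed.

Lemma cconj_scale A (c : R[i]) (z : cplx A) :
  cconj (c *: z) = complex.conjc c *: cconj z.
Proof.
case: c => p q; apply: cplxP => /=; first by rewrite scaleNr scalerN opprK.
by rewrite scalerN scaleNr opprD.
Qed.

Lemma cplx_bilin_bilinear A B C (b : A -> B -> C) :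
  is_bilinear b -> is_bilinear (cplx_bilin b).
Proof.
have linr A' B' (b' : A' -> B' -> C) : is_bilinear b' ->
    forall x, linear (cplx_bilin b' x).
  move=> bb [x y] [p q] [u v] [u' v'].
  apply: cplxP => /=; rewrite !(bilinDr bb, bilinNr bb, bilinZr bb) !(scalerBr, scalerDr).
    by rewrite !opprD !addrA (ACl (1*4*2*5*3*6)%AC).
  by rewrite !addrA (ACl (1*4*2*5*3*6)%AC).
move=> bb; split; first exact: linr.
move=> w c z z'.
have flip u : cplx_bilin b u w = cplx_bilin (fun y x => b x y) w u.
  by apply: cplxP => //=; rewrite addrC.
by rewrite !flip; apply: linr; case: bb => br bl; split.
Qed.

Lemma cplx_bilin_conj A B C (b : A -> B -> C) z w : is_bilinear b ->
  cplx_bilin b (cconj z) (cconj w) = cconj (cplx_bilin b z w).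
Proof.
move=> bb; apply: cplxP; rewrite /= !(bilinNr bb, bilinNl bb) ?opprK //.
by rewrite opprD.
Qed.

Lemma cplx_bilin_real A B C (b : A -> B -> C) x y : is_bilinear b ->
  cplx_bilin b (creal x) (creal y) = creal (b x y).
Proof.
move=> bb; apply: cplxP; rewrite /= !(bilin0r bb, bilin0l bb) ?subr0 //.
by rewrite addr0.
Qed.

Lemma cplx_leibniz G A B C (b : A -> B -> C) (a1 : G -> A -> A)
    (a2 : G -> B -> B) (a3 : G -> C -> C) :
  is_bilinear b -> is_bilinear a3 ->
  (forall x y z, a3 x (b y z) = b (a1 x y) z + b y (a2 x z)) ->
  forall x y z, cplx_bilin a3 x (cplx_bilin b y z) =
    cplx_bilin b (cplx_bilin a1 x y) z + cplx_bilin b y (cplx_bilin a2 x z).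
Proof.
move=> bb b3 leib [x x'] [y y'] [z z'].
apply: cplxP => /=.
  rewrite !(bilinDr bb, bilinNr bb, bilinDl bb, bilinNl bb).
  rewrite !(bilinDr b3, bilinNr b3) !leib !opprD !addrA ?opprK.
  by rewrite (ACl (1*7*3*5*2*6*4*8)%AC).
rewrite !(bilinDr bb, bilinNr bb, bilinDl bb, bilinNl bb).
rewrite !(bilinDr b3, bilinNr b3) !leib !opprD !addrA ?opprK.
by rewrite (ACl (1*7*3*5*2*6*4*8)%AC).
Qed.

Lemma cplx_lie_module G A (br : G -> G -> G) (act : G -> A -> A) :
  is_bilinear br -> is_lie_module br act ->
  is_lie_module (cplx_bilin br) (cplx_bilin act).
Proof.
move=> bbr mact; have [bact _] := mact.
split=> [|x y m]; first exact: cplx_bilin_bilinear.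
apply/eqP; rewrite eq_sym subr_eq; apply/eqP; apply: cplx_leibniz => // u v w.
exact: (module_leibniz _ _ _ mact).
Qed.

Lemma cplx_lie_bracket G (br : G -> G -> G) :
  is_lie_bracket br -> is_lie_bracket (cplx_bilin br).
Proof.
move=> lbr; have bbr := lie_bilinear lbr.
have alt z : cplx_bilin br z z = 0.
  apply: cplxP => /=; first by rewrite !lie_alternating ?subr0.
  by rewrite [X in _ + X](lie_antisym lbr) subrr.
split=> // [|x y z]; first exact: cplx_bilin_bilinear.
have bC := cplx_bilin_bilinear bbr.
have anti u v : cplx_bilin br u v = - cplx_bilin br v u.
  have := alt (u + v); rewrite (bilinDl bC) !(bilinDr bC) !alt.
  by rewrite add0r addr0 => /eqP; rewrite addr_eq0 => /eqP.
have [_ E] := cplx_lie_module bbr (adjoint_module lbr).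
rewrite (anti z (cplx_bilin br x y)) E (anti z x) (bilinNr bC).
by rewrite opprB addrC addrA subrK subrr.
Qed.

End ComplexBilinear.

Section RealLift.
Variables (R : realType) (g0 A : vectType R).
Variables (br : g0 -> g0 -> g0) (act : g0 -> A -> A).
Hypothesis br_lie : is_lie_bracket br.
Hypothesis act_module : is_lie_module br act.
Variables (h : {vspace cplx g0}) (X : dual h -> cplx g0) (a : dual h).
Variable t : cplx g0.
Hypothesis eft : sl2_triple (cplx_bilin br) (X a) (X (- a)) t.
Hypothesis X_conj : X (- a) = - cconj (X a).

(** Conjugation turns [exp e * exp (- f) * exp e] into
[exp (- f) * exp e * exp (- f)], and these two products agree. *)
Lemma weyl_lift_conj v :
  weyl_lift1 (cplx_bilin act) X a (cconj v) =
  cconj (weyl_lift1 (cplx_bilin act) X a v).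
Proof.
have br_lieC := cplx_lie_bracket br_lie.
have mC := cplx_lie_module (lie_bilinear br_lie) act_module.
have ne := nilpotent_X eft mC.
have nf := nilpotent_XN br_lieC eft mC.
have [bact _] := act_module.
have ccN : cconj (X a) = - X (- a) by rewrite X_conj opprK.
have cc : cconj (- X (- a)) = X a by rewrite X_conj opprK cconjK.
have E u : vexp (cplx_bilin act (- X (- a))) (cconj u) =
    cconj (vexp (cplx_bilin act (X a)) u).
  by apply: vexp_intertwine => // w; rewrite -ccN cplx_bilin_conj.
have F u : vexp (cplx_bilin act (X a)) (cconj u) =
    cconj (vexp (cplx_bilin act (- X (- a))) u).
  by apply: vexp_intertwine => // w; rewrite -[in LHS]cc cplx_bilin_conj.
have := sl2_braid br_lieC mC eft v; rewrite /weyl_lift1 /=.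
move: E F; move: (vexp _) (vexp _) => p q E F ->.
by rewrite -F -E -F.
Qed.

End RealLift.

(** * Chevalley bases adapted to a compact real form *)

Lemma imaginary_scale (R : realType) (A : vectType R) (z : cplx A) :
  ('i : R[i]) *: z = Cplx (- cim z) (cre z).
Proof.
rewrite -complexiE; apply: cplxP => /=; first by rewrite scale0r sub0r scale1r.
by rewrite scale0r add0r scale1r.
Qed.

Lemma mem_real_span (R : realType) (V : lmodType R[i]) (s : seq V) x :
  x \in s -> real_span s x.
Proof.
move=> /(nthP 0) [i lti <-]; pose i' := Ordinal lti.
exists (fun j => (j == i')%:R); rewrite (bigD1 i') //= eqxx.
rewrite big1 ?addr0 => [|j /negPf ->]; last by rewrite scale0r.
by rewrite scale1r.
Qed.

Lemma imaginary_cconj (A : zmodType) (z : cplx A) : cre z = 0 -> z = - cconj z.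
Proof. by move=> z0; apply: cplxP; rewrite /= ?opprK // z0 oppr0. Qed.

Section AdaptedBasis.
Variables (R : realType) (g0 : vectType R) (br : g0 -> g0 -> g0).
Hypothesis br_lie : is_lie_bracket br.
Variable F : g0 -> g0 -> R^o.
Hypothesis F_bilin : is_bilinear F.
Hypothesis F_sym : forall x y, F x y = F y x.
Hypothesis F_pos : forall x, x != 0 -> 0 < F x x.
Hypothesis F_inv : forall x y z, F (br x y) z = - F y (br x z).

Notation g := (cplx g0).
Notation brC := (cplx_bilin br).
Variables (h : {vspace g}) (Phi Delta : seq (dual h)).
Variables (Hv : dual h -> subvs_of h) (X : dual h -> g).
Hypothesis Phi_roots : root_system brC Phi.
Hypothesis Delta_base : root_base Phi Delta.
Hypothesis Hv_dual : killing_dual brC Phi Hv.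
Hypothesis X_chevalley : chevalley_basis brC Phi Delta Hv X.
Hypothesis X_g0 : adapted_to_real_form br Phi Delta Hv X.

Let bbr := lie_bilinear br_lie.
Let bbrC := cplx_bilin_bilinear bbr.

Lemma form_ge0 x : 0 <= F x x.
Proof.
have [->|/F_pos /ltW //] := eqVneq x 0.
by rewrite (bilin0l F_bilin).
Qed.

Lemma form_eq0 x : F x x = 0 -> x = 0.
Proof. by move=> Fx; apply/eqP/negPn/negP => /F_pos; rewrite Fx ltxx. Qed.

Lemma form_skew k x : F (br k x) x = 0.
Proof.
have /eqP := F_inv k x x; rewrite [F x _]F_sym -addr_eq0 -mulr2n mulrn_eq0 /=.
by move=> /eqP.
Qed.

Lemma generator_real x :
  x \in compact_generators br Phi Delta Hv X -> cim x = 0.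
Proof. by move=> /mem_real_span; rewrite -X_g0 => -[y _ <-]. Qed.

Lemma tau_imaginary d : d \in Delta -> cre (vsval (tau brC Hv d)) = 0.
Proof.
move=> dD; have := @generator_real ('i *: vsval (tau brC Hv d)).
rewrite imaginary_scale; apply; rewrite /compact_generators !mem_cat -imaginary_scale.
by rewrite (map_f (fun a => 'i *: vsval (tau brC Hv a)) dD).
Qed.

Lemma cconj_X_positive b : b \in positive_roots Phi Delta ->
  X (- b) = - cconj (X b).
Proof.
move=> bP; have := @generator_real (X b - X (- b)).
rewrite /compact_generators !mem_cat (map_f (fun b => X b - X (- b)) bP) orbT.
move=> /(_ isT) /= im_eq.
have := @generator_real ('i *: X b + 'i *: X (- b)).
rewrite /compact_generators !mem_cat.
rewrite (map_f (fun b => 'i *: X b + 'i *: X (- b)) bP) !orbT.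
rewrite !imaginary_scale /= => /(_ isT) re_eq.
apply: cplxP => /=.
  by apply/eqP; rewrite -addr_eq0 addrC re_eq.
by rewrite opprK; apply/esym/eqP; rewrite -subr_eq0; apply/eqP.
Qed.

(** The coroots of a base are free, and their number is the dimension of the dual
of [h]. *)
Lemma tau_span : <<[seq vsval (tau brC Hv a) | a <- Delta]>>%VS = h.
Proof.
apply/eqP; rewrite eqEdim; apply/andP; split.
  by apply/span_subvP => x /mapP[a _ ->]; exact: subvsP.
have [bX _ _ _] := X_chevalley.
have /eqP -> := catr_free (basis_free bX); rewrite size_map.
have [_ bD _] := Delta_base.
have := size_basis (X := in_tuple Delta) bD.
rewrite dimvf /dim /= => <-.
by rewrite muln1.
Qed.

Lemma cartan_spanned (H : subvs_of h) : exists c : 'I_(size Delta) -> R[i],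
  H = \sum_(i < size Delta) c i *: tau brC Hv Delta`_i.
Proof.
have := subvsP H; rewrite -{2}tau_span -[S in span S]in_tupleE => /coord_span.
set S := in_tuple _ => HS.
have sz : size Delta = size [seq vsval (tau brC Hv a) | a <- Delta].
  by rewrite size_map.
exists (fun i => coord S (cast_ord sz i) (vsval H)).
apply: subvs_inj; rewrite linear_sum [LHS]HS (reindex (cast_ord sz)); last first.
  by exists (cast_ord (esym sz)) => j _; rewrite ?cast_ordK ?cast_ordKV.
apply: eq_bigr => i _; rewrite linearZZ; congr (_ *: _).
by rewrite -[LHS]/([seq vsval (tau brC Hv a) | a <- Delta]`_i) (nth_map 0).
Qed.

(** Roots are real on the coroots, because [ad] of an element of the compact
form is skew symmetric. *)
Lemma root_real a d : a \in Phi -> d \in Delta ->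
  complex.Im (a (tau brC Hv d)) = 0.
Proof.
move=> aP dD; have [_ /(_ a) [/(_ aP) [_ [x x0 xa]] _]] := Phi_roots.
have := xa (tau brC Hv d); have := tau_imaginary dD.
case: (vsval (tau brC Hv d)) => _ k /= ->.
case: (a (tau brC Hv d)) => p q; case: x x0 {xa} => u v uv0.
move=> [] /=; rewrite !(bilin0l bbr) !sub0r !add0r => ku kv.
have Ev : p * F u v - q * F v v = 0.
  have := form_skew k v; rewrite -[br k v]opprK ku.
  rewrite opprB (bilinBl F_bilin) !(bilinZl F_bilin) => /eqP.
  by rewrite subr_eq0 => /eqP E; apply/eqP; rewrite subr_eq0; exact/eqP/esym/E.
have Eu : p * F u v + q * F u u = 0.
  by have := form_skew k u; rewrite kv (bilinDl F_bilin) !(bilinZl F_bilin) F_sym.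
have : q * (F u u + F v v) = 0.
  rewrite mulrDr; apply/eqP; rewrite addr_eq0; apply/eqP.
  by apply: (addrI (p * F u v)); rewrite Eu Ev.
move/eqP; rewrite mulf_eq0 paddr_eq0 ?form_ge0 // => /orP[/eqP //|].
move=> /andP[/eqP /form_eq0 u0 /eqP /form_eq0 v0].
by move: uv0; rewrite u0 v0 eqxx.
Qed.

Lemma root_nonzero_on_coroots a : a \in Phi ->
  exists2 d, d \in Delta & a (tau brC Hv d) != 0.
Proof.
move=> aP; have [_ /(_ a) [/(_ aP) [a0 _] _]] := Phi_roots.
apply/hasP; apply: contraNT a0 => /hasPn a_tau.
apply/eqP/lfunP => H; rewrite zero_lfunE; have [c ->] := cartan_spanned H.
rewrite linear_sum big1 // => i _; rewrite linearZ /=.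
by have := a_tau _ (mem_nth 0 (ltn_ord i)); rewrite negbK => /eqP ->; rewrite scaler0.
Qed.

(** Conjugation exchanges the root spaces of [a] and [- a]. *)
Lemma opp_root a : a \in Phi -> - a \in Phi.
Proof.
move=> aP; have [_ Phi_root] := Phi_roots.
have [/(_ aP) [a0 [x x0 xa]] _] := Phi_root a.
apply/Phi_root; split; first by rewrite oppr_eq0.
exists (cconj x).
  by apply: contraNneq x0 => x0; rewrite -[x]cconjK x0 raddf0.
suff tauP c d : d \in Delta -> brC (vsval (c *: tau brC Hv d)) (cconj x) =
    (- a) (c *: tau brC Hv d) *: cconj x.
  move=> H; have [c ->] := cartan_spanned H.
  rewrite !linear_sum (bilin_suml bbrC) scaler_suml; apply: eq_bigr => i _.
  exact/tauP/mem_nth.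
move=> dD; set td := tau brC Hv d.
have -> : brC (vsval (c *: td)) (cconj x) = c *: brC (vsval td) (cconj x).
  by rewrite -(bilinZl bbrC); congr (brC _ _); exact: linearZZ.
have -> : (- a) (c *: td) = c * (- a) td by exact: linearZZ.
rewrite -scalerA; congr (_ *: _).
rewrite (imaginary_cconj (tau_imaginary dD)).
rewrite (bilinNl bbrC) cplx_bilin_conj // xa cconj_scale opp_lfunE scaleNr.
congr (- (_ *: _)).
by have := root_real aP dD; case: (a _) => p q /= ->; rewrite oppr0.
Qed.

(** The generators [X b - X (- b)] and [i X b + i X (- b)] are real for positive [b];
negative roots follow by applying conjugation once more. *)
Lemma cconj_X b : b \in Phi -> X (- b) = - cconj (X b).
Proof.
move=> bP; have [_ _ /(_ b bP) [nb|nb]] := Delta_base.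
  by apply: cconj_X_positive; rewrite mem_filter bP andbT; apply/asboolP.
have := @cconj_X_positive (- b); rewrite opprK => ->.
  by rewrite raddfN /= cconjK opprK.
by rewrite mem_filter opp_root // andbT; apply/asboolP.
Qed.

Lemma X_neq0 a : a \in Phi -> X a != 0.
Proof.
move=> aP; have [bX _ _ _] := X_chevalley.
by apply: (basis_not0 bX); rewrite mem_cat map_f.
Qed.

(** If [H_a] were isotropic, the quotient that defines [tau a] would be [0], and
[X a], [X (- a)] would commute, that is, [br u v = 0] for the real and imaginary
parts [u], [v] of [X a]. Choose a simple coroot [i k] with [a (i k) = p] nonzero;
then [F (br u v) k = p * F v v], so that [v = 0], and then [u = 0]. *)
Lemma root_killing_neq0 a : a \in Phi ->
  killing brC (vsval (Hv a)) (vsval (Hv a)) != 0.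
Proof.
move=> aP; apply/negP => /eqP Ba.
have [_ Xroot brX _] := X_chevalley.
have := brX _ aP; rewrite /tau Ba invr0 mulr0 scale0r linear0.
have := X_neq0 aP; rewrite cconj_X //.
have [d dD ad0] := root_nonzero_on_coroots aP.
have := Xroot _ aP (tau brC Hv d); have := tau_imaginary dD.
case: (vsval (tau brC Hv d)) => _ k /= ->.
have := root_real aP dD; move: ad0; case: (a (tau brC Hv d)) => p q /=.
move=> + q0; rewrite {}q0; case: (X a) => u v pn0.
have {}pn0 : p != 0 by apply: contraNneq pn0 => ->.
move=> [] /=; rewrite !(bilin0l bbr) !scale0r !sub0r subr0 add0r addr0 => ku kv.
move=> uv0 [] _; rewrite opprK (bilinNr bbr) -(lie_antisym br_lie) -mulr2n.
move/eqP; rewrite -scaler_nat scaler_eq0 pnatr_eq0 /= => /eqP uv.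
have Fvv : F v v = 0.
  have := F_inv u v k; rewrite uv (bilin0l F_bilin) (lie_antisym br_lie) kv.
  rewrite (bilinNr F_bilin) (bilinZr F_bilin) opprK => /esym/eqP.
  by rewrite scaler_eq0 (negPf pn0) => /eqP.
have v0 := form_eq0 Fvv.
move: ku; rewrite v0 (bilin0r bbr) oppr0 => /esym/eqP.
by rewrite scaler_eq0 (negPf pn0) => /eqP u0; move: uv0; rewrite u0 v0 eqxx.
Qed.

Lemma chevalley_sl2 a : a \in Phi ->
  sl2_triple brC (X a) (X (- a)) (vsval (tau brC Hv a)).
Proof.
move=> aP; have [_ Xroot brX _] := X_chevalley.
have ata : a (tau brC Hv a) = 2.
  by rewrite linearZ /= -(Hv_dual aP) /= [_ *: _]divfK ?root_killing_neq0.
split; first exact: brX.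
  by rewrite Xroot // ata.
by rewrite (Xroot _ (opp_root aP)) opp_lfunE ata.
Qed.

End AdaptedBasis.

(** * The nilpotent algebra *)

Section DotForms.
Variables (R : realType) (V : vectType R) (ip : {dot V for idfun}).

(** An inner product with values in the regular module, where bilinearity in the
sense of [is_bilinear] makes sense. *)
Definition dot_form : V -> V -> R^o := fun x y => ip x y.

Lemma dot_form_bilinear : is_bilinear dot_form.
Proof.
split=> [x|y] a u v; rewrite /dot_form.
  by rewrite linearPr.
by rewrite linearPl.
Qed.

Lemma dot_form_sym x y : dot_form x y = dot_form y x.
Proof. by rewrite /dot_form hermC expr0 mul1r. Qed.

Lemma dot_form_pos x : x != 0 -> 0 < dot_form x x.
Proof. exact: neq0_dnorm_gt0. Qed.

End DotForms.

Section NilpotentAlgebra.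
Variables (R : realType) (g0 U : vectType R).
Notation n0 := (U * g0)%type.
Variables (br : g0 -> g0 -> g0) (act : g0 -> U -> U).
Hypothesis br_lie : is_lie_bracket br.
Hypothesis act_module : is_lie_module br act.

Definition n0_action (Z : g0) (x : n0) : n0 := (act Z x.1, br Z x.2).

Lemma n0_action_module : is_lie_module br n0_action.
Proof.
have [[actr actl] actM] := act_module; have [brr brl] := lie_bilinear br_lie.
split; first split.
- by move=> Z a x y; congr pair; [exact: actr | exact: brr].
- by move=> x a Y Z; congr pair; [exact: actl | exact: brl].
- move=> x y z; congr pair; first exact: actM.
  by have [_] := adjoint_module br_lie; apply.
Qed.

(** Tested against [(0, Z)], the bracket of [U] is [Z |-> ip (Z u) u'], and the
derivation rule becomes the module identity for [br X Z] together with skewness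
of [act X] and [br X]. *)
Lemma n0_action_derivation ip nbr X x y :
  adapted_inner_product br act ip -> is_n0_bracket act ip nbr ->
  n0_action X (nbr x y) = nbr (n0_action X x) y + nbr x (n0_action X y).
Proof.
move=> [_ ip_act ip_br] [nbr_lie central nbr1 nbr_ip].
have nb := lie_bilinear nbr_lie; have ipb := dot_form_bilinear ip.
have [[actr actl] actM] := act_module.
have nbrE u v : nbr u v = nbr (u.1, 0) (v.1, 0).
  have split_pair (w : n0) : w = (w.1, 0) + (0, w.2).
    by case: w => a b; congr pair; rewrite /= ?addr0 ?add0r.
  rewrite {1}(split_pair u) {1}(split_pair v) (bilinDl nb) central addr0.
  by rewrite (bilinDr nb) [nbr _ (0, _)](lie_antisym nbr_lie) central oppr0 addr0.
pose w u v := (nbr (u, 0) (v, 0)).2.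
have nbrw u v : nbr u v = (0, w u.1 v.1).
  by rewrite nbrE [LHS]surjective_pairing nbr1.
have w_ip u v Z : dot_form ip (0, w u v) (0, Z) = dot_form ip (act Z u, 0) (v, 0).
  by rewrite /dot_form -nbr_ip nbrw.
rewrite !nbrw /n0_action /=.
rewrite -[RHS]/(0 + 0, w (act X x.1) y.1 + w x.1 (act X y.1)) addr0.
congr pair; first exact: (bilin0r act_module.1).
set A := br X _; set B := _ + _.
have eq_ip Z : dot_form ip (0, A) (0, Z) = dot_form ip (0, B) (0, Z).
  have -> : ((0 : U), B) = (0, w (act X x.1) y.1) + (0, w x.1 (act X y.1)).
    by congr pair; rewrite addr0.
  rewrite (bilinDl ipb) !w_ip {1}/dot_form ip_br -/(dot_form ip _ _) w_ip.
  rewrite actM.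
  have -> : (act X (act Z x.1) - act Z (act X x.1), 0 : g0) =
    (act X (act Z x.1), 0) - (act Z (act X x.1), 0) by congr pair; rewrite subr0.
  by rewrite (bilinBl ipb) opprB {2}/dot_form ip_act opprK.
have : dot_form ip (0, A - B) (0, A - B) = 0.
  have {1}-> : ((0 : U), A - B) = (0, A) - (0, B) by congr pair; rewrite subr0.
  by rewrite (bilinBl ipb) eq_ip subrr.
move=> AB0; apply/eqP; rewrite -subr_eq0; apply/negPn/negP => AB.
have /(dot_form_pos ip) : ((0, A - B) : n0) != 0.
  by rewrite -pair_eqE /= negb_and AB orbT.
by rewrite AB0 ltxx.
Qed.

End NilpotentAlgebra.

Section Zeta.
Variables (R : realType) (g0 U : vectType R).
Notation n0 := (U * g0)%type.

Fact n_V_additive : {morph (@n_V _ g0 U) : x y / x - y}.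
Proof. by move=> x y; apply: cplxP. Qed.
HB.instance Definition _ :=
  GRing.isZmodMorphism.Build (cplx n0) (cplx U) (@n_V _ g0 U) n_V_additive.

Fact n_g_additive : {morph (@n_g _ g0 U) : x y / x - y}.
Proof. by move=> x y; apply: cplxP. Qed.
HB.instance Definition _ :=
  GRing.isZmodMorphism.Build (cplx n0) (cplx g0) (@n_g _ g0 U) n_g_additive.

Variables (br : g0 -> g0 -> g0) (act : g0 -> U -> U).
Hypothesis br_lie : is_lie_bracket br.
Hypothesis act_module : is_lie_module br act.
Variables (h : {vspace cplx g0}) (X : dual h -> cplx g0).

Lemma zeta_weyl_lift1 a t :
  sl2_triple (cplx_bilin br) (X a) (X (- a)) t ->
  zeta (weyl_lift1 (cplx_bilin act) X a) (weyl_lift1 (cplx_bilin br) X a) =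
  weyl_lift1 (cplx_bilin (n0_action br act)) X a.
Proof.
move=> eft; apply/funext => z; rewrite /zeta.
have bbr := lie_bilinear br_lie; have br_lieC := cplx_lie_bracket br_lie.
have mact := cplx_lie_module bbr act_module.
have mad := cplx_lie_module bbr (adjoint_module br_lie).
have mn0 := cplx_lie_module bbr (n0_action_module br_lie act_module).
rewrite (weyl_lift_intertwine br_lieC eft z mact mn0) //.
rewrite (weyl_lift_intertwine br_lieC eft z mad mn0) //.
by apply: cplxP; rewrite /= -surjective_pairing.
Qed.

Lemma zeta_compose_all (T : dual h -> cplx U -> cplx U)
    (phi : dual h -> cplx g0 -> cplx g0) (L : dual h -> cplx n0 -> cplx n0) bs :
  {in bs, forall a, zeta (T a) (phi a) = L a} ->
  zeta (compose_all T bs) (compose_all phi bs) = compose_all L bs.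
Proof.
elim: bs => [_|a bs IH zL] /=.
  by apply/funext => z; apply: cplxP; rewrite /= -surjective_pairing.
rewrite -IH => [|b bbs]; last by rewrite zL // in_cons bbs orbT.
rewrite -zL ?mem_head //; apply/funext => z; rewrite /zeta /=.
by congr n_sum; [congr (T a _) | congr (phi a _)]; apply: cplxP.
Qed.

End Zeta.

Lemma compose_all_ind (I : eqType) (V : Type) (P : (V -> V) -> Prop)
    (F : I -> V -> V) (s : seq I) :
  P id -> (forall f g, P f -> P g -> P (f \o g)) ->
  {in s, forall i, P (F i)} -> P (compose_all F s).
Proof.
move=> P1 Pcomp; elim: s => //= i s IH PF; apply: Pcomp.
  by apply: PF; rewrite mem_head.
by apply: IH => j js; apply: PF; rewrite in_cons js orbT.
Qed.

Section RealRestriction.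
Variables (R : realType) (A : vectType R) (nbr : A -> A -> A).
Hypothesis nbr_bilin : is_bilinear nbr.
Variable Z : cplx A -> cplx A.
Hypothesis Z_aut : lie_aut (cplx_bilin nbr) Z.
Hypothesis Z_conj : forall z, Z (cconj z) = cconj (Z z).

(** Discarding the imaginary part loses nothing: a map that commutes with
conjugation preserves the real points. *)
Definition real_restriction (x : A) : A := cre (Z (creal x)).

Lemma cconj_creal (x : A) : cconj (creal x) = creal x.
Proof. by apply: cplxP; rewrite //= oppr0. Qed.

Lemma cconj_fixed (z : cplx A) : cconj z = z -> z = creal (cre z).
Proof.
case: z => x y [] /eqP; rewrite eq_sym -addr_eq0 -mulr2n -scaler_nat.
by rewrite scaler_eq0 pnatr_eq0 /= => /eqP ->.
Qed.

Lemma real_restrictionE x : Z (creal x) = creal (real_restriction x).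
Proof. by apply: cconj_fixed; rewrite -Z_conj cconj_creal. Qed.

Lemma real_restriction_onto y : exists x, Z (creal x) = creal y.
Proof.
have [_ [Z' ZK KZ] _] := Z_aut.
exists (cre (Z' (creal y))); rewrite -cconj_fixed ?KZ //.
by apply: (can_inj ZK); rewrite Z_conj KZ cconj_creal.
Qed.

Lemma creal_inj : injective (@creal A).
Proof. by move=> x y []. Qed.

Lemma real_restriction_image : Z @` range (@creal A) = range (@creal A).
Proof.
apply/seteqP; split=> z.
  by move=> [_ [x _ <-] <-]; exists (real_restriction x); rewrite ?real_restrictionE.
move=> [y _ <-]; have [x Zx] := real_restriction_onto y.
by exists (creal x) => //; exists x.
Qed.

Lemma real_restriction_aut : lie_aut nbr real_restriction.
Proof.
have [linZ [Z' ZK KZ] morphZ] := Z_aut.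
have creal_lin c (x y : A) : creal (c *: x + y) = (c%:C)%C *: creal x + creal y.
  apply: cplxP => /=; rewrite scale0r ?subr0 //.
  by rewrite scaler0 !addr0.
have lin_r : linear real_restriction.
  move=> c x y; apply: creal_inj.
  by rewrite -real_restrictionE !creal_lin linZ !real_restrictionE.
split=> //; last first.
  move=> x y; apply: creal_inj.
  by rewrite -!cplx_bilin_real // -!real_restrictionE -cplx_bilin_real // morphZ.
apply: injective_bijective => // x y /(congr1 (@creal A)).
by rewrite -!real_restrictionE => /(can_inj ZK) /creal_inj.
Qed.

End RealRestriction.

(** * Weyl group lifts on the nilpotent algebra *)

Section N0Symmetries.
Variables (R : realType) (g0 U : vectType R).
Notation n0 := (U * g0)%type.
Variables (br : g0 -> g0 -> g0) (act : g0 -> U -> U) (nbr : n0 -> n0 -> n0).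

(** Properties of the lift of one reflection that are stable under composition and
imply the theorem. The form is the complex bilinear one, not the hermitian one:
each of the three exponentials preserves the former. *)
Definition n0_symmetry (Z : cplx n0 -> cplx n0) : Prop :=
  [/\ lie_aut (cplx_bilin nbr) Z, forall z, Z (cconj z) = cconj (Z z) &
      forall ip : {dot n0 for idfun}, invariant_inner_product br act ip ->
      forall y z, cplx_bilin (dot_form ip) (Z y) (Z z) =
                  cplx_bilin (dot_form ip) y z].

Lemma n0_symmetry_id : n0_symmetry id.
Proof. by split=> //; split=> //; exists id. Qed.

Lemma n0_symmetry_comp Z Z' :
  n0_symmetry Z -> n0_symmetry Z' -> n0_symmetry (Z \o Z').
Proof.
move=> [[lZ bZ mZ] cZ fZ] [[lZ' bZ' mZ'] cZ' fZ']; split.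
- split; last by move=> x y; rewrite /= mZ' mZ.
    by move=> c x y; rewrite /= lZ' lZ.
  exact: bij_comp.
- by move=> z; rewrite /= cZ' cZ.
- by move=> ip inv y z; rewrite /= fZ // fZ'.
Qed.

Hypothesis br_lie : is_lie_bracket br.
Hypothesis act_module : is_lie_module br act.
Variable ip : {dot n0 for idfun}.
Hypothesis ip_adapted : adapted_inner_product br act ip.
Hypothesis nbr_n0 : is_n0_bracket act ip nbr.
Variables (h : {vspace cplx g0}) (X : dual h -> cplx g0) (a : dual h).
Variable t : cplx g0.
Hypothesis eft : sl2_triple (cplx_bilin br) (X a) (X (- a)) t.
Hypothesis X_conj : X (- a) = - cconj (X a).

Lemma weyl_lift_n0_symmetry :
  n0_symmetry (weyl_lift1 (cplx_bilin (n0_action br act)) X a).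
Proof.
have bbr := lie_bilinear br_lie; have br_lieC := cplx_lie_bracket br_lie.
have mn0 := n0_action_module br_lie act_module.
have mC := cplx_lie_module bbr mn0.
have [bn0 _] := mn0.
have nbb : is_bilinear nbr by case: nbr_n0 => nl *; exact: lie_bilinear.
split.
- have lin := weyl_lift_linear br_lieC eft mC.
  have bij := weyl_lift_bij br_lieC eft mC.
  split=> //.
  move=> x y; apply: (weyl_lift_leibniz br_lieC eft) => //.
    exact: cplx_bilin_bilinear.
  apply: cplx_leibniz => // Z u v.
  exact: n0_action_derivation ip_adapted nbr_n0.
- exact: (weyl_lift_conj br_lie mn0 eft X_conj).
- move=> ip' inv y z; have fb := dot_form_bilinear ip'.
  rewrite -(weyl_lift_leibniz br_lieC eft y z mC mC (trivial_module _ _)).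
  + exact: weyl_lift_trivial.
  + exact: cplx_bilin_bilinear.
  + move=> x u v; have b0 : is_bilinear (fun (_ : g0) (_ : R^o) => 0 : R^o).
      by split=> w c p q; rewrite scaler0 addr0.
    rewrite -(cplx_leibniz (a1 := n0_action br act) (a2 := n0_action br act) fb b0).
      by apply: cplxP; rewrite /= ?subr0 ?addr0.
    move=> Z p q; apply/esym/eqP; rewrite addr_eq0; apply/eqP; exact: inv.
Qed.

End N0Symmetries.

Theorem proposition6p15 (R : realType)
  (g0 : vectType R) (br : g0 -> g0 -> g0)
  (br_lie : is_lie_bracket br) (g0_compact : compact_semisimple br)
  (U : vectType R) (act : g0 -> U -> U) (act_module : is_lie_module br act)
  (ip : {dot (U * g0)%type for idfun})
  (ip_adapted : adapted_inner_product br act ip)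
  (nbr : U * g0 -> U * g0 -> U * g0) (nbr_n0 : is_n0_bracket act ip nbr)
  (h : {vspace cplx g0}) (h_cartan : cartan_subalgebra (cplx_bilin br) h)
  (Phi : seq (dual h)) (Phi_roots : root_system (cplx_bilin br) Phi)
  (Delta : seq (dual h)) (Delta_base : root_base Phi Delta)
  (Hv : dual h -> subvs_of h) (Hv_dual : killing_dual (cplx_bilin br) Phi Hv)
  (X : dual h -> cplx g0)
  (X_chevalley : chevalley_basis (cplx_bilin br) Phi Delta Hv X)
  (X_g0 : adapted_to_real_form br Phi Delta Hv X)
  (sigma : subvs_of h -> subvs_of h)
  (sigma_W : weyl (cplx_bilin br) Phi Hv sigma)
  (bs : seq (dual h)) (bs_roots : {subset bs <= Phi})
  (sigma_bs : sigma = compose_all (reflection (cplx_bilin br) Hv) bs) :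
  let T_sigma := compose_all (weyl_lift1 (cplx_bilin act) X) bs in
  let phi_sigma := compose_all (weyl_lift1 (cplx_bilin br) X) bs in
  let zeta_sigma := zeta T_sigma phi_sigma in
  [/\ lie_aut (cplx_bilin nbr) zeta_sigma,
      zeta_sigma @` range (@creal (U * g0)%type) = range (@creal (U * g0)%type)
    & exists f : U * g0 -> U * g0,
      [/\ forall x, zeta_sigma (creal x) = creal (f x),
          lie_aut nbr f &
          forall ip' : {dot (U * g0)%type for idfun},
            invariant_inner_product br act ip' ->
            forall x y, ip' (f x) (f y) = ip' x y]].
Proof.
move=> T_sigma phi_sigma zeta_sigma.
pose F (x y : g0) : R^o := dot_form ip (0, x) (0, y).
have ipb := dot_form_bilinear ip.
have F_bilin : is_bilinear F.
  split=> [x|y] c u v; rewrite /F.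
    have -> : ((0 : U), c *: u + v) = c *: (0, u) + (0, v).
      by congr pair; rewrite /= scaler0 addr0.
    exact: ipb.1.
  have -> : ((0 : U), c *: u + v) = c *: (0, u) + (0, v).
    by congr pair; rewrite /= scaler0 addr0.
  exact: (ipb.2 (0, y)).
have F_sym x y : F x y = F y x by exact: dot_form_sym.
have F_pos x : x != 0 -> 0 < F x x.
  by move=> x0; apply: dot_form_pos; rewrite -pair_eqE /= negb_and x0 orbT.
have F_inv x y z : F (br x y) z = - F y (br x z).
  by have [_ _] := ip_adapted; apply.
have eft a (aP : a \in Phi) := chevalley_sl2 br_lie F_bilin F_sym F_pos F_inv
  Phi_roots Delta_base Hv_dual X_chevalley X_g0 aP.
have X_conj a (aP : a \in Phi) := cconj_X br_lie F_bilin F_sym F_pos F_inv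
  Phi_roots Delta_base X_chevalley X_g0 aP.
have zetaE : zeta_sigma =
    compose_all (weyl_lift1 (cplx_bilin (n0_action br act)) X) bs.
  by apply: zeta_compose_all => a /bs_roots /eft; exact: zeta_weyl_lift1.
have [Z_aut Z_conj Z_form] : n0_symmetry br act nbr zeta_sigma.
  rewrite zetaE; apply: compose_all_ind.
  - exact: n0_symmetry_id.
  - exact: n0_symmetry_comp.
  - move=> a /bs_roots aP.
    exact: (weyl_lift_n0_symmetry br_lie act_module ip_adapted nbr_n0
      (eft _ aP) (X_conj _ aP)).
have nbb : is_bilinear nbr by case: nbr_n0 => nl *; exact: lie_bilinear.
split=> //; first exact: (real_restriction_image Z_aut Z_conj).
exists (real_restriction zeta_sigma); split.
- exact: (real_restrictionE Z_conj).
- exact: (real_restriction_aut nbb Z_aut Z_conj).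
- move=> ip' inv x y; have fb := dot_form_bilinear ip'.
  apply: (@creal_inj R (R^o : vectType R)).
  have := Z_form ip' inv (creal x) (creal y).
  by rewrite !(real_restrictionE Z_conj) !cplx_bilin_real.
Qed.
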